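(* Let $A$ be an integer matrix with columns indexed by a finite set $\mathcal{I}$ of cells, and assume there is a vector $\mathbf{w}$ with $\mathbf{w}^\prime A=(1,\ldots,1)$. Let $\mathcal{B}_{\rm GR}$ be the Graver basis of $A$ (the set of all primitive moves) and let $\mathcal{B}_0\subset\mathcal{B}_{\rm GR}$ be the subset of its square-free moves. Then $\mathcal{B}_0$ is strongly distance reducing for tables with zero-one entries. That is, for every $\mathbf{t}$ and all $\mathbf{x},\mathbf{y}\in\tilde{\mathcal{F}}_{\mathbf{t}}$ with $\mathbf{x}\ne\mathbf{y}$ there exist $\mathbf{z}_1,\mathbf{z}_2\in\mathcal{B}_0$ and $\epsilon_1,\epsilon_2\in\{+1,-1\}$ such that $\mathbf{x}+\epsilon_1\mathbf{z}_1\in\tilde{\mathcal{F}}_{\mathbf{t}}$, $\mathbf{y}+\epsilon_2\mathbf{z}_2\in\tilde{\mathcal{F}}_{\mathbf{t}}$, $|\mathbf{x}+\epsilon_1\mathbf{z}_1-\mathbf{y}|<|\mathbf{x}-\mathbf{y}|$ and $|\mathbf{x}-(\mathbf{y}+\epsilon_2\mathbf{z}_2)|<|\mathbf{x}-\mathbf{y}|$.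
   Context: For an integer matrix $A$ with columns indexed by a finite set $\mathcal{I}$, a (contingency) table is a vector $\mathbf{x}=(x(i))_{i\in\mathcal{I}}$ of nonnegative integers. The zero-one fiber of $\mathbf{t}$ is $\tilde{\mathcal{F}}_{\mathbf{t}}=\{\mathbf{x}\in\{0,1\}^{\mathcal{I}} : A\mathbf{x}=\mathbf{t}\}$. A move is an integer vector $\mathbf{z}=(z(i))_{i\in\mathcal{I}}$ with $A\mathbf{z}=\mathbf{0}$; it is square-free if all its entries lie in $\{-1,0,1\}$. $|\mathbf{z}|=\sum_{i}|z(i)|$ is the $L_1$-norm. A sum $\mathbf{z}_1+\mathbf{z}_2$ of two moves is conformal if there is no cell $i$ at which $z_1(i)$ and $z_2(i)$ have opposite (nonzero) signs. A nonzero move is primitive if it cannot be written as a conformal sum of two nonzero moves. The set of primitive moves is finite and is called the Graver basis of $A$. *)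

(* Defs.v *)
From mathcomp Require Import all_boot all_order all_algebra.

Set Implicit Arguments.
Unset Strict Implicit.
Unset Printing Implicit Defensive.

Import Order.TTheory GRing.Theory Num.Theory.
Local Open Scope ring_scope.

(* An integer matrix whose columns are indexed by the finite type I of cells
   is given by its family of columns A : I -> 'cV[int]_d, and an integer vector
   indexed by the cells is an element of {ffun I -> int}. *)

Definition mxapp (d : nat) (I : finType) (A : I -> 'cV[int]_d)
    (x : {ffun I -> int}) : 'cV[int]_d :=
  \sum_(i : I) x i *: A i.

(* The weight vector w has entries in an ordered field R, into which the
   integer entries of A are cast. *)
Definition homogeneous (R : realFieldType) (d : nat) (I : finType)
    (A : I -> 'cV[int]_d) : Prop :=
  exists w : 'cV[R]_d,
    forall i : I, \sum_(k < d) w k 0 * (A i k 0)%:~R = 1.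

Definition zero_one_fiber (d : nat) (I : finType) (A : I -> 'cV[int]_d)
    (t : 'cV[int]_d) (x : {ffun I -> int}) : Prop :=
  (forall i, x i = 0 \/ x i = 1) /\ mxapp A x = t.

Definition is_move (d : nat) (I : finType) (A : I -> 'cV[int]_d)
    (z : {ffun I -> int}) : Prop :=
  mxapp A z = 0.

Definition square_free (I : finType) (z : {ffun I -> int}) : Prop :=
  forall i, [\/ z i = -1, z i = 0 | z i = 1].

Definition l1norm (I : finType) (z : {ffun I -> int}) : int :=
  \sum_(i : I) `|z i|.

Definition conformal (I : finType) (z1 z2 : {ffun I -> int}) : Prop :=
  ~ exists i, (0 < z1 i /\ z2 i < 0) \/ (z1 i < 0 /\ 0 < z2 i).

Definition primitive_move (d : nat) (I : finType) (A : I -> 'cV[int]_d)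
    (z : {ffun I -> int}) : Prop :=
  [/\ is_move A z, z <> 0 &
      ~ exists z1 z2 : {ffun I -> int},
          [/\ is_move A z1 /\ z1 <> 0, is_move A z2 /\ z2 <> 0,
              conformal z1 z2 & z = z1 + z2]].

(* Sets of integer vectors are represented by their membership predicates. *)
Definition graver_basis (d : nat) (I : finType) (A : I -> 'cV[int]_d) :
    {ffun I -> int} -> Prop :=
  fun z => primitive_move A z.

Definition square_free_graver (d : nat) (I : finType) (A : I -> 'cV[int]_d) :
    {ffun I -> int} -> Prop :=
  fun z => graver_basis A z /\ square_free z.

Definition strongly_distance_reducing01 (d : nat) (I : finType)
    (A : I -> 'cV[int]_d) (B : {ffun I -> int} -> Prop) : Prop :=
  forall (t : 'cV[int]_d) (x y : {ffun I -> int}),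
    zero_one_fiber A t x -> zero_one_fiber A t y -> x <> y ->
    exists (z1 z2 : {ffun I -> int}) (e1 e2 : int),
      [/\ B z1 /\ B z2,
          (e1 = 1 \/ e1 = -1) /\ (e2 = 1 \/ e2 = -1),
          zero_one_fiber A t (x + z1 *~ e1) /\
          zero_one_fiber A t (y + z2 *~ e2),
          l1norm (x + z1 *~ e1 - y) < l1norm (x - y) &
          l1norm (x - (y + z2 *~ e2)) < l1norm (x - y)].

(* Main.v *)
Require Import Defs.
From mathcomp Require Import all_boot all_order all_algebra.
From mathcomp Require Import zify.

Set Implicit Arguments.
Unset Strict Implicit.
Unset Printing Implicit Defensive.

Import Order.TTheory GRing.Theory Num.Theory.
Local Open Scope ring_scope.

(** The difference [x - y] of two zero-one tables is a square-free move, so its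
    conformal parts are exactly its restrictions to sets of cells. Restricting
    it to a minimal set on which it is still a nonzero move gives a primitive
    square-free move [p], and [x - p], [y + p] lie cellwise between [x] and [y].
    Both new differences equal [(x - y) - p], which is [x - y] with the nonzero
    entries of [p] erased. *)

Definition restrict (I : finType) (z : {ffun I -> int}) (S : {set I}) :
    {ffun I -> int} :=
  [ffun i => if i \in S then z i else 0].

Lemma mxappD (d : nat) (I : finType) (A : I -> 'cV[int]_d)
    (x y : {ffun I -> int}) : mxapp A (x + y) = mxapp A x + mxapp A y.
Proof.
by rewrite /mxapp -big_split; apply: eq_bigr => i _; rewrite ffunE scalerDl.
Qed.

Lemma mxappB (d : nat) (I : finType) (A : I -> 'cV[int]_d)
    (x y : {ffun I -> int}) : mxapp A (x - y) = mxapp A x - mxapp A y.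
Proof.
by apply/eqP; rewrite -(inj_eq (addIr (mxapp A y))) -mxappD !subrK.
Qed.

(** An entry in {-1, 0, 1} is never a sum of two nonzero integers of equal sign, so wherever [z1] is
    nonzero, [z2] vanishes and [z1] carries the whole entry. *)
Lemma conformal_summand_restrict (I : finType) (z z1 z2 : {ffun I -> int})
    (S : {set I}) :
  square_free z -> conformal z1 z2 -> restrict z S = z1 + z2 ->
  z1 = restrict z (S :&: [set i | z1 i != 0]).
Proof.
move=> zsf zconf zE; apply/ffunP => i; rewrite ffunE !inE.
have zi : ~ (0 < z1 i /\ z2 i < 0 \/ z1 i < 0 /\ 0 < z2 i).
  by move=> ?; apply: zconf; exists i.
have := congr1 (fun f : {ffun I -> int} => f i) zE.
rewrite !ffunE; have [->|] := eqVneq (z1 i) 0; first by rewrite andbF.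
rewrite andbT => /eqP; move: (zsf i) zi; move: (z i) (z1 i) (z2 i) => a b c.
by case: ifP => _ [] *; lia.
Qed.

Lemma square_free_restrict (I : finType) (z : {ffun I -> int}) (S : {set I}) :
  square_free z -> square_free (restrict z S).
Proof. by move=> zsf i; rewrite ffunE; case: ifP => _ //; apply: Or32. Qed.

(** Minimality forces primitivity: a nonzero conformal summand that is a move lives on a subset of
    [S], which must then be all of [S], leaving zero for the other summand. *)
Lemma primitive_restrict_exists (d : nat) (I : finType) (A : I -> 'cV[int]_d)
    (z : {ffun I -> int}) :
  is_move A z -> square_free z -> z <> 0 ->
  exists S : {set I}, primitive_move A (restrict z S).
Proof.
move=> zmove zsf zn0.
pose P S := (restrict z S != 0) && (mxapp A (restrict z S) == 0).
have PT : P setT.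
  have -> : P setT = (z != 0) && (mxapp A z == 0).
    by rewrite /P; have -> // : restrict z setT = z
      by apply/ffunP => i; rewrite ffunE inE.
  by rewrite zmove eqxx andbT; apply/eqP.
have [S /minsetP[/andP[Sn0 /eqP Smove] Smin] _] := minset_exists PT.
exists S; split=> //; first exact/eqP.
case=> z1 [z2 [[z1move z1n0] [_ z2n0] zconf zE]].
have z1E := conformal_summand_restrict zsf zconf zE.
set S1 := S :&: _ in z1E.
have S1E : S1 = S.
  apply: Smin; last exact: subsetIl.
  by rewrite /P -z1E z1move eqxx andbT; apply/eqP.
by apply: z2n0; apply: (addrI z1); rewrite -zE addr0 z1E S1E.
Qed.

Lemma l1norm_subr_restrict_lt (I : finType) (z : {ffun I -> int})
    (S : {set I}) :
  restrict z S <> 0 -> l1norm (z - restrict z S) < l1norm z.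
Proof.
move=> pn0; have [i pi] : exists i, restrict z S i != 0.
  apply/existsP; apply: contraT => /existsPn p0; case: pn0.
  by apply/ffunP => i; rewrite [RHS]ffunE; apply/eqP/negPn/p0.
(* Strictness comes from the cell [i], whose nonzero entry is erased; every other entry is either
   kept or erased. *)
rewrite /l1norm (bigD1 i) //= [ltRHS](bigD1 i) //=; apply: ltr_leD.
  by move: pi; rewrite !ffunE; case: ifP => // _; rewrite subrr normr0 normr_gt0.
apply: ler_sum => j _; rewrite !ffunE; case: ifP => _; last by rewrite subr0.
by rewrite subrr normr0.
Qed.

Theorem proposition2p1 (R : realFieldType) (d : nat) (I : finType)
    (A : I -> 'cV[int]_d) (hA : homogeneous R A) :
  strongly_distance_reducing01 A (square_free_graver A).
Proof.
move=> t x y [x01 xt] [y01 yt] xy.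
have zmove : is_move A (x - y) by rewrite /is_move mxappB xt yt subrr.
have zsf : square_free (x - y).
  move=> i; rewrite !ffunE; case: (x01 i) => ->; case: (y01 i) => ->;
    by [apply: Or31 | apply: Or32 | apply: Or33].
have zn0 : x - y <> 0 by move/eqP; rewrite subr_eq0 => /eqP.
have [S pprim] := primitive_restrict_exists zmove zsf zn0.
have [pmove pn0 _] := pprim.
have pB : square_free_graver A (restrict (x - y) S).
  by split=> //; apply: square_free_restrict.
have plt := l1norm_subr_restrict_lt pn0.
(* One move serves both tables: subtracting it brings [x] towards [y], adding it brings [y] towards
   [x]. *)
exists (restrict (x - y) S), (restrict (x - y) S), (-1), 1.
rewrite mulrN1z mulr1z; split=> //.
- by split; [right | left].
(* On [S] each table takes the value of the other one, and off [S] it keeps its own, so the entries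
   stay zero-one. *)
- split; split; rewrite ?mxappB ?mxappD ?pmove ?subr0 ?addr0 // => i;
    rewrite !ffunE; move: (x01 i) (y01 i); move: (x i) (y i) => a b;
    by case: ifP => _; lia.
- by rewrite addrAC.
- by rewrite opprD addrA.
Qed.
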